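(* Let $\lambda>1$, $\theta>0$, $\lambda_j=\lambda^j$, and let $s\ge\theta$. Assume $(a^0,b^0)\in H^s\times H^s$ and $f=(f_0,f_1,f_2,\dots)\in H^s$ (time-independent). Then there exists a time $T>0$ such that the system $$\frac{d}{dt}a_j=-\left(\lambda_j^{\theta}a_ja_{j+1}-\lambda_{j-1}^{\theta}a_{j-1}^2\right)+\left(\lambda_j^{\theta}b_jb_{j+1}-\lambda_{j-1}^{\theta}b_{j-1}^2\right)+f_j,\qquad \frac{d}{dt}b_j=-\left(\lambda_j^{\theta}a_jb_{j+1}-\lambda_j^{\theta}b_ja_{j+1}\right),$$ for $j\ge0$ with $a_{-1}=b_{-1}=0$, with initial data $(a(0),b(0))=(a^0,b^0)$, has a unique solution $(a(t),b(t))$ in $H^s\times H^s$ on $[0,T]$.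
   Context: For $s\in\mathbb R$, $H^s$ is the space of real sequences $u=(u_0,u_1,\dots)$ with $\|u\|_{H^s}^2=\sum_{j\ge0}\lambda_j^{2s}u_j^2<\infty$. A solution in $H^s\times H^s$ on $[0,T]$ is a pair $(a(t),b(t))$, $t\in[0,T]$, with $a_j,b_j\in C^1([0,T])$ satisfying the equations for all $j\ge0$, and with $\|a(t)\|_{H^s}$ and $\|b(t)\|_{H^s}$ finite and bounded on $[0,T]$. Uniqueness is within this class. *)

(* Defs.v *)
From Stdlib Require Import Reals.
From Coquelicot Require Import Coquelicot.
Open Scope R_scope.

Definition shell (lambda : R) (j : nat) : R := lambda ^ j.

Definition Hs_term (lambda s : R) (u : nat -> R) (j : nat) : R :=
  Rpower (shell lambda j) (2 * s) * (u j) ^ 2.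

Definition in_Hs (lambda s : R) (u : nat -> R) : Prop :=
  ex_series (Hs_term lambda s u).

(* [Series] is a junk value on divergent series, so [Hs_norm] is only meaningful
   together with [in_Hs]. *)
Definition Hs_norm (lambda s : R) (u : nat -> R) : R :=
  sqrt (Series (Hs_term lambda s u)).

(* lambda_{j-1}^theta u_{j-1}^2, with the convention u_{-1} = 0. *)
Definition inflow (lambda theta : R) (u : nat -> R) (j : nat) : R :=
  match j with
  | O => 0
  | S i => Rpower (shell lambda i) theta * (u i) ^ 2
  end.

Definition rhs_a (lambda theta : R) (f a b : nat -> R) (j : nat) : R :=
  - (Rpower (shell lambda j) theta * a j * a (S j) - inflow lambda theta a j)
  + (Rpower (shell lambda j) theta * b j * b (S j) - inflow lambda theta b j)
  + f j.

Definition rhs_b (lambda theta : R) (a b : nat -> R) (j : nat) : R :=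
  - (Rpower (shell lambda j) theta * a j * b (S j)
     - Rpower (shell lambda j) theta * b j * a (S j)).

Definition Icc (x y t : R) : Prop := x <= t <= y.

(* [D_in] and [continue_in] are relative to the interval, hence one-sided at its
   endpoints; the values of g outside [0,T] are irrelevant. *)
Definition C1_on (T : R) (g : R -> R) : Prop :=
  exists dg : R -> R, forall t, Icc 0 T t ->
    D_in g dg (Icc 0 T) t /\ continue_in dg (Icc 0 T) t.

Definition bounded_in_Hs (lambda s T : R) (u : R -> nat -> R) : Prop :=
  (forall t, Icc 0 T t -> in_Hs lambda s (u t)) /\
  exists M : R, forall t, Icc 0 T t -> Hs_norm lambda s (u t) <= M.

Record is_solution (lambda theta s T : R) (f a0 b0 : nat -> R)
    (a b : R -> nat -> R) : Prop := {
  sol_C1_a : forall j, C1_on T (fun t => a t j);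
  sol_C1_b : forall j, C1_on T (fun t => b t j);
  sol_eq_a : forall j t, Icc 0 T t ->
    D_in (fun r => a r j) (fun r => rhs_a lambda theta f (a r) (b r) j) (Icc 0 T) t;
  sol_eq_b : forall j t, Icc 0 T t ->
    D_in (fun r => b r j) (fun r => rhs_b lambda theta (a r) (b r) j) (Icc 0 T) t;
  sol_init_a : forall j, a 0 j = a0 j;
  sol_init_b : forall j, b 0 j = b0 j;
  sol_bounded_a : bounded_in_Hs lambda s T a;
  sol_bounded_b : bounded_in_Hs lambda s T b
}.

(* Main.v *)
Require Import Defs.
From Stdlib Require Import Reals Factorial Lra Lia.
From Coquelicot Require Import Coquelicot.
Open Scope R_scope.

(** Since [theta <= s], the factor [lambda_j^theta] in each quadratic term can be
    absorbed by one of its two factors.  Hence on a set [{|u_j| <= w_j}] with [w]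
    in [H^s] the vector field is Lipschitz for the unweighted sup norm, with a
    constant depending on [|w|_{H^s}] only.  For [g = |a0| + |b0| + |f|] the
    recursion [w_j = 2 g_j + eps w_{j-1}] with small [eps] gives a [w] in [H^s]
    whose set is invariant under Picard iteration on a short time interval.  The
    iteration converges in sup norm, and the domination by [w] gives the [H^s]
    bound.  Two [H^s]-bounded solutions coincide by the same Lipschitz estimate. *)

(** * Calculus on [[0,T]] with one-sided derivatives at the endpoints *)

(** For [0 <= T] this is the nearest-point retraction of the line onto [[0,T]]. Composing with it
    extends functions controlled only on the interval to the whole line, where two-sided notions
    apply. *)
Definition clip (T t : R) : R := Rmax 0 (Rmin T t).

Lemma clip_range (T t : R) : 0 <= T -> Icc 0 T (clip T t).
Proof.
  intros hT; unfold clip, Icc, Rmax, Rmin.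
  destruct (Rle_dec T t); destruct (Rle_dec 0 _); lra.
Qed.

Lemma clip_id (T t : R) : Icc 0 T t -> clip T t = t.
Proof.
  unfold clip, Icc, Rmax, Rmin; intros h.
  destruct (Rle_dec T t); destruct (Rle_dec 0 _); lra.
Qed.

Lemma clip_contracts (T x y : R) : Rabs (clip T x - clip T y) <= Rabs (x - y).
Proof.
  unfold clip, Rmax, Rmin, Rabs.
  destruct (Rle_dec T x); destruct (Rle_dec T y);
    repeat (destruct (Rle_dec 0 _)); repeat (destruct (Rcase_abs _)); lra.
Qed.

Lemma continue_in_clip (T : R) (g : R -> R) (x : R) :
  0 <= T -> (forall t, Icc 0 T t -> continue_in g (Icc 0 T) t) ->
  continuity_pt (fun t => g (clip T t)) x.
Proof.
  intros hT hg eps heps.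
  destruct (hg _ (clip_range T x hT) eps heps) as [alp [halp h]].
  exists alp; split; [exact halp|].
  intros y [_ hy]; cbn in *; unfold Rdist in *.
  (* [continue_in] is a punctured limit and says nothing when the two clipped times coincide, as
     happens for two times beyond the same endpoint. *)
  destruct (Req_dec (clip T x) (clip T y)) as [e | ne].
  - rewrite e, Rminus_diag, Rabs_R0; exact heps.
  - apply h; repeat split; try apply clip_range; auto.
    eapply Rle_lt_trans; [apply clip_contracts | exact hy].
Qed.

Lemma D_in_interior (T : R) (g dg : R -> R) (t : R) :
  0 < t < T -> D_in g dg (Icc 0 T) t -> is_derive g t (dg t).
Proof.
  intros ht h; apply is_derive_Reals; intros eps heps.
  destruct (h eps heps) as [alp [halp hd]]; cbn in hd; unfold Rdist in hd.
  assert (hpos : 0 < Rmin alp (Rmin t (T - t))) by (repeat apply Rmin_pos; lra).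
  exists (mkposreal _ hpos); intros k hk0 hk; cbn in hk.
  assert (h1 := Rmin_l alp (Rmin t (T - t))).
  assert (h2 := Rmin_r alp (Rmin t (T - t))).
  assert (h3 := Rmin_l t (T - t)); assert (h4 := Rmin_r t (T - t)).
  assert (hk' := Rabs_def2 _ _ hk).
  specialize (hd (t + k)); replace (t + k - t) with k in hd by ring.
  apply hd; split; [split; [unfold Icc; lra | lra] | lra].
Qed.

Lemma is_derive_D_in (D : R -> Prop) (g dg : R -> R) (t : R) :
  is_derive g t (dg t) -> D_in g dg D t.
Proof.
  intros h; apply is_derive_Reals in h; intros eps heps.
  destruct (h eps heps) as [alp halp].
  exists alp; split; [apply cond_pos|].
  intros x [[_ hx] hd]; cbn in *; unfold Rdist in *.
  specialize (halp (x - t)); replace (t + (x - t)) with x in halp by ring.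
  apply halp; [lra | exact hd].
Qed.

Lemma D_in_ext (D : R -> Prop) (g h dg dh : R -> R) (t : R) :
  D t -> (forall r, D r -> g r = h r) -> dg t = dh t ->
  D_in g dg D t -> D_in h dh D t.
Proof.
  intros ht hgh hd hD eps heps.
  destruct (hD eps heps) as [alp [halp hx]].
  exists alp; split; [exact halp|].
  intros x [[hx1 hx2] hx3]; rewrite <- hd, <- !hgh by assumption.
  apply hx; repeat split; assumption.
Qed.

(** [C t^(n+1) - g] vanishes at 0 and has nonnegative derivative, so the mean value theorem applies.
    The shape of the bound lets it be iterated to produce factorials. *)
Lemma le_of_power_derive_bound (T : R) (g dg : R -> R) (C : R) (n : nat) :
  (forall t, Icc 0 T t -> D_in g dg (Icc 0 T) t) -> g 0 = 0 ->
  (forall t, Icc 0 T t -> dg t <= C * INR (S n) * t ^ n) ->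
  forall t, Icc 0 T t -> g t <= C * t ^ S n.
Proof.
  intros hg g0 hdg t ht; unfold Icc in ht.
  destruct (Req_dec t 0) as [-> | hne]; [rewrite g0, pow_i by lia; lra|].
  (* The mean value theorem asks for two-sided continuity at 0 and [t], where [g] may be only
     one-sidedly differentiable; clipping supplies it and changes nothing inside. *)
  pose (k := fun x => C * clip T x ^ S n - g (clip T x)).
  assert (hT : 0 <= T) by lra.
  destruct (MVT_gen k 0 t (fun x => C * (INR (S n) * x ^ n) - dg x)) as [c [hc e]].
  - rewrite Rmin_left, Rmax_right by lra; intros x hx.
    apply (is_derive_ext_loc (fun x => C * x ^ S n - g x)).
    + assert (hpos : 0 < Rmin x (T - x)) by (apply Rmin_pos; lra).
      exists (mkposreal _ hpos); intros y hy.
      change (Rabs (y - x) < Rmin x (T - x)) in hy.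
      assert (h1 := Rmin_l x (T - x)); assert (h2 := Rmin_r x (T - x)).
      apply Rabs_def2 in hy.
      unfold k; rewrite clip_id by (unfold Icc; lra); reflexivity.
    + apply is_derive_Reals, derivable_pt_lim_minus.
      * apply derivable_pt_lim_scal, derivable_pt_lim_pow.
      * apply is_derive_Reals, (D_in_interior T); [lra|].
        apply hg; unfold Icc; lra.
  - intros x _; unfold k.
    apply (continue_in_clip T (fun y => C * y ^ S n - g y) x hT); intros r hr.
    apply (cont_deriv _ (fun x => C * (INR (S n) * x ^ n) - dg x)).
    apply Dminus; [|apply hg; exact hr].
    apply is_derive_D_in, is_derive_Reals.
    apply derivable_pt_lim_scal, derivable_pt_lim_pow.
  - rewrite Rmin_left, Rmax_right in hc by lra.
    unfold k in e; rewrite !clip_id in e by (unfold Icc; lra).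
    rewrite g0, pow_i in e by lia.
    assert (hd := hdg c ltac:(unfold Icc; lra)); nra.
Qed.

(** * Uniqueness for sup-norm Lipschitz systems *)

Lemma le_0_of_le_vanishing (x : R) (u : nat -> R) :
  is_lim_seq u 0 -> (forall n, x <= u n) -> x <= 0.
Proof.
  intros hu hx.
  exact (is_lim_seq_le (fun _ => x) u x 0 hx (is_lim_seq_const x) hu).
Qed.

(* Iterating the integral inequality gives [|x - y| <= D (L t)^n / n!] for all n. *)
Lemma sup_lipschitz_ode_unique (I : Type) (F : (I -> R) -> I -> R)
  (T L D : R) (x y : R -> I -> R) :
  0 <= D ->
  (forall t i, Icc 0 T t ->
     D_in (fun r => x r i) (fun r => F (x r) i) (Icc 0 T) t) ->
  (forall t i, Icc 0 T t ->
     D_in (fun r => y r i) (fun r => F (y r) i) (Icc 0 T) t) ->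
  (forall i, x 0 i = y 0 i) ->
  (forall t i, Icc 0 T t -> Rabs (x t i - y t i) <= D) ->
  (forall t d, Icc 0 T t -> (forall i, Rabs (x t i - y t i) <= d) ->
     forall i, Rabs (F (x t) i - F (y t) i) <= L * d) ->
  forall t i, Icc 0 T t -> x t i = y t i.
Proof.
  intros hD hx hy h0 hb hL.
  assert (hn : forall n t i, Icc 0 T t ->
            Rabs (x t i - y t i) <= D * L ^ n / INR (fact n) * t ^ n).
  { induction n as [|n IH]; intros t i ht.
    - simpl; replace (D * 1 / 1 * 1) with D by field; auto.
    - assert (hf : INR (fact n) <> 0) by apply INR_fact_neq_0.
      assert (hS : INR (S n) <> 0) by (apply not_0_INR; lia).
      (* The Lipschitz hypothesis is used with [d] equal to the bound of stage [n] at time [r]; the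
         factor [S n] cancels against [(S n)!]. *)
      assert (hC : forall r j, Icc 0 T r ->
        Rabs (F (x r) j - F (y r) j)
          <= D * L ^ S n / INR (fact (S n)) * INR (S n) * r ^ n).
      { intros r j hr.
        replace (D * L ^ S n / INR (fact (S n)) * INR (S n) * r ^ n)
          with (L * (D * L ^ n / INR (fact n) * r ^ n)).
        - apply hL; auto.
        - rewrite fact_simpl, mult_INR; simpl pow; field; auto. }
      (* The power bound is one-sided, so it is applied to both [y - x] and [x - y]. *)
      apply Rabs_le; split.
      + apply Ropp_le_cancel; rewrite Ropp_involutive.
        replace (- (x t i - y t i)) with (y t i - x t i) by ring.
        apply (le_of_power_derive_bound T (fun r => y r i - x r i)
                 (fun r => F (y r) i - F (x r) i)); auto.
        * intros r hr; apply Dminus; auto.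
        * rewrite h0; ring.
        * intros r hr; eapply Rle_trans; [|apply (hC r i hr)].
          rewrite Rabs_minus_sym; apply Rle_abs.
      + apply (le_of_power_derive_bound T (fun r => x r i - y r i)
                 (fun r => F (x r) i - F (y r) i)); auto.
        * intros r hr; apply Dminus; auto.
        * rewrite h0; ring.
        * intros r hr; eapply Rle_trans; [|apply (hC r i hr)].
          apply Rle_abs. }
  intros t i ht; apply Rminus_diag_uniq.
  assert (h : Rabs (x t i - y t i) <= 0).
  { apply (le_0_of_le_vanishing _ (fun n => D * ((L * t) ^ n / INR (fact n)))).
    - replace (Finite 0) with (Rbar_mult D 0)
        by (simpl; rewrite Rmult_0_r; reflexivity).
      apply is_lim_seq_scal_l, is_lim_seq_Reals, cv_speed_pow_fact.
    - intros n; specialize (hn n t i ht).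
      rewrite Rpow_mult_distr; unfold Rdiv in *; lra. }
  destruct (Rabs_pos (x t i - y t i)); unfold Rabs in *; destruct (Rcase_abs _); lra.
Qed.

(** * Picard iteration in an order interval *)

(** The order interval [[-w,w]] is closed under coordinatewise limits, so it carries an [H^s] bound
    through a convergence that is only in sup norm. *)
Definition dominated (I : Type) (w x : I -> R) : Prop :=
  forall i, Rabs (x i) <= w i.
Arguments dominated {I} w x.

Definition continuous_paths (I : Type) (x : R -> I -> R) : Prop :=
  forall i t, continuous (fun r => x r i) t.
Arguments continuous_paths {I} x.

(* Time is clipped to [0,T] so that the iterates are defined, continuous and
   bounded on the whole line. *)
Definition picard_step (I : Type) (F : (I -> R) -> I -> R) (T : R) (x0 : I -> R)
    (x : R -> I -> R) : R -> I -> R :=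
  fun t i => x0 i + RInt (fun r => F (x r) i) 0 (clip T t).
Arguments picard_step {I} F T x0 x.

Fixpoint picard_iter (I : Type) (F : (I -> R) -> I -> R) (T : R) (x0 : I -> R)
    (n : nat) : R -> I -> R :=
  match n with
  | O => fun _ => x0
  | S m => picard_step F T x0 (picard_iter I F T x0 m)
  end.
Arguments picard_iter {I} F T x0 n.

Lemma ex_RInt_of_continuous (g : R -> R) (a b : R) :
  (forall t, continuous g t) -> ex_RInt g a b.
Proof. intros hg; apply (ex_RInt_continuous (V := R_CompleteNormedModule)); auto. Qed.

Lemma is_derive_RInt_of_continuous (g : R -> R) (t : R) :
  (forall r, continuous g r) -> is_derive (fun y => RInt g 0 y) t (g t).
Proof.
  intros hg; apply (is_derive_RInt g (fun y => RInt g 0 y) 0 t); [|apply hg].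
  apply filter_forall; intros y.
  apply (RInt_correct (V := R_CompleteNormedModule)), ex_RInt_of_continuous, hg.
Qed.

Lemma continuous_clip (T t : R) : continuous (clip T) t.
Proof.
  apply continuity_pt_filterlim; intros eps heps.
  exists eps; split; [exact heps|].
  intros y [_ hy]; cbn in *; unfold Rdist in *.
  eapply Rle_lt_trans; [apply clip_contracts | exact hy].
Qed.

Lemma picard_step_continuous (I : Type) (F : (I -> R) -> I -> R) (T : R)
  (x0 : I -> R) (x : R -> I -> R) :
  continuous_paths (fun r => F (x r)) -> continuous_paths (picard_step F T x0 x).
Proof.
  intros hF i t; unfold picard_step.
  apply (continuous_plus (fun _ => x0 i)); [apply continuous_const|].
  apply (continuous_comp (clip T) (fun y => RInt (fun r => F (x r) i) 0 y));
    [apply continuous_clip|].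
  apply (ex_derive_continuous (K := R_AbsRing) (V := R_NormedModule)).
  eexists; apply (is_derive_RInt_of_continuous (fun r => F (x r) i)), hF.
Qed.

Lemma Rabs_RInt_clip_le (g : R -> R) (T M t : R) :
  0 <= T -> (forall r, continuous g r) -> (forall r, Rabs (g r) <= M) ->
  Rabs (RInt g 0 (clip T t)) <= T * M.
Proof.
  intros hT hg hM; destruct (clip_range T t hT) as [h0 h1].
  assert (0 <= M) by (eapply Rle_trans; [apply Rabs_pos | apply (hM 0)]).
  eapply Rle_trans.
  - apply abs_RInt_le_const; [lra | apply ex_RInt_of_continuous, hg | auto].
  - apply Rmult_le_compat_r; lra.
Qed.

(** [|x0| + T B <= w] is the self-map condition: the integral over a time at most [T] moves
    coordinate [i] by at most [T B i]. *)
Lemma picard_step_dominated (I : Type) (F : (I -> R) -> I -> R) (T : R)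
  (x0 B w : I -> R) (x : R -> I -> R) (t : R) :
  0 <= T -> continuous_paths (fun r => F (x r)) ->
  (forall r i, Rabs (F (x r) i) <= B i) ->
  (forall i, Rabs (x0 i) + T * B i <= w i) ->
  dominated w (picard_step F T x0 x t).
Proof.
  intros hT hc hB hw i; unfold picard_step.
  eapply Rle_trans; [apply Rabs_triang|].
  eapply Rle_trans; [|apply hw].
  apply Rplus_le_compat_l, Rabs_RInt_clip_le; auto.
Qed.

Lemma picard_step_contracts (I : Type) (F : (I -> R) -> I -> R) (T M : R)
  (x0 : I -> R) (x y : R -> I -> R) (t : R) (i : I) :
  0 <= T ->
  continuous_paths (fun r => F (x r)) -> continuous_paths (fun r => F (y r)) ->
  (forall r, Rabs (F (x r) i - F (y r) i) <= M) ->
  Rabs (picard_step F T x0 x t i - picard_step F T x0 y t i) <= T * M.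
Proof.
  intros hT hx hy hM; unfold picard_step.
  match goal with |- Rabs (?p + ?a - (?p + ?b)) <= _ =>
    replace (p + a - (p + b)) with (a - b) by ring end.
  rewrite <- (RInt_minus (V := R_CompleteNormedModule)
    (fun r => F (x r) i) (fun r => F (y r) i))
    by (apply ex_RInt_of_continuous; intros r; auto).
  apply Rabs_RInt_clip_le; auto.
  intros r; apply (continuous_minus (fun r => F (x r) i)); auto.
Qed.

(** The Picard map preserves the order interval and, since [T L <= 1/2], halves sup distances; [W]
    bounds the initial distance. Continuity of [F] along paths is a separate hypothesis, because a
    sup-norm Lipschitz bound does not preserve merely coordinatewise continuity. *)
Lemma picard_lindelof_sup (I : Type) (F : (I -> R) -> I -> R)
  (T L W : R) (x0 B w : I -> R) :
  0 <= T -> 0 <= L -> 0 <= W -> T * L <= / 2 ->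
  (forall x, continuous_paths x -> continuous_paths (fun r => F (x r))) ->
  (forall i, 0 <= B i) ->
  (forall x i, dominated w x -> Rabs (F x i) <= B i) ->
  (forall i, Rabs (x0 i) + T * B i <= w i) ->
  (forall i, w i <= W) ->
  (forall x y d, dominated w x -> dominated w y ->
     (forall i, Rabs (x i - y i) <= d) ->
     forall i, Rabs (F x i - F y i) <= L * d) ->
  exists x : R -> I -> R,
    continuous_paths x /\ (forall t, dominated w (x t)) /\
    (forall i, x 0 i = x0 i) /\
    forall t i, Icc 0 T t ->
      D_in (fun r => x r i) (fun r => F (x r) i) (Icc 0 T) t.
Proof.
  intros hT hL hW hTL hcont hB0 hB hw hwW hLip.
  set (P := picard_iter F T x0).
  assert (hx0 : dominated w x0).
  { intros i; assert (h := hw i); assert (h' := hB0 i); nra. }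
  assert (hP : forall n, continuous_paths (P n) /\ forall t, dominated w (P n t)).
  { induction n as [|n [IHc IHd]]; split.
    - intros i t; apply continuous_const.
    - intros t; apply hx0.
    - apply picard_step_continuous, hcont, IHc.
    - intros t; apply (picard_step_dominated _ F T x0 B); auto. }
  assert (hstep : forall x y d, continuous_paths x -> continuous_paths y ->
    (forall t, dominated w (x t)) -> (forall t, dominated w (y t)) ->
    (forall t i, Rabs (x t i - y t i) <= d) ->
    forall t i, Rabs (picard_step F T x0 x t i - picard_step F T x0 y t i) <= d / 2).
  { intros x y d cx cy dx dy hd t i.
    assert (0 <= d) by (eapply Rle_trans; [apply Rabs_pos | apply (hd 0 i)]).
    eapply Rle_trans;
      [apply (picard_step_contracts _ F T (L * d)); auto | nra]. }
  (* Uniform Cauchy estimate: each induction step peels one Picard step off both iterates, and at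
     [N = 0] both lie in [[-W,W]]. *)
  assert (hdiff : forall N n m t i, (N <= n)%nat -> (N <= m)%nat ->
            Rabs (P n t i - P m t i) <= 2 * W * (/ 2) ^ N).
  { induction N as [|N IH]; intros n m t i hn hm.
    - assert (h1 := proj2 (hP n) t i); assert (h2 := proj2 (hP m) t i).
      assert (h3 := hwW i); apply Rabs_le_between in h1, h2.
      simpl; apply Rabs_le; lra.
    - destruct n as [|n]; [lia|]; destruct m as [|m]; [lia|].
      replace (2 * W * (/ 2) ^ S N) with (2 * W * (/ 2) ^ N / 2) by (simpl; field).
      apply hstep; try apply hP; intros r j; apply IH; lia. }
  assert (hgeom : forall c, is_lim_seq (fun n => c * (/ 2) ^ n) 0).
  { intros c; replace (Finite 0) with (Rbar_mult c 0)
      by (simpl; rewrite Rmult_0_r; reflexivity).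
    apply is_lim_seq_scal_l, is_lim_seq_geom; rewrite Rabs_pos_eq; lra. }
  assert (hsmall : forall eps, 0 < eps -> exists N, 2 * W * (/ 2) ^ N < eps).
  { intros eps heps; destruct (proj1 (is_lim_seq_Reals _ _) (hgeom (2 * W)) eps heps)
      as [N hN].
    exists N; specialize (hN N (le_n N)); unfold Rdist in hN.
    apply Rabs_def2 in hN; lra. }
  pose (x := fun t i => real (Lim_seq (fun n => P n t i))).
  assert (hlim : forall t i, is_lim_seq (fun n => P n t i) (x t i)).
  { intros t i; apply Lim_seq_correct', ex_lim_seq_cauchy_corr.
    intros eps; destruct (hsmall eps (cond_pos eps)) as [N hN].
    exists N; intros n m hn hm.
    eapply Rle_lt_trans; [apply (hdiff N); assumption | exact hN]. }
  assert (hrate : forall n t i, Rabs (x t i - P n t i) <= 2 * W * (/ 2) ^ n).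
  { intros n t i.
    apply (is_lim_seq_le (fun m => Rabs (P (m + n)%nat t i - P n t i))
             (fun _ => 2 * W * (/ 2) ^ n) (Rabs (x t i - P n t i))
             (2 * W * (/ 2) ^ n)).
    - intros m; apply hdiff; lia.
    - apply (is_lim_seq_abs _ (Finite (x t i - P n t i))).
      apply is_lim_seq_minus'; [|apply is_lim_seq_const].
      apply (is_lim_seq_incr_n (fun m => P m t i)), hlim.
    - apply is_lim_seq_const. }
  assert (hxc : continuous_paths x).
  { intros i t; apply continuity_pt_filterlim.
    (* The rate in [hrate] does not depend on the time, so the convergence is uniform and the radius
       1 is arbitrary. *)
    apply (CVU_continuity (fun n r => P n r i) _ t (mkposreal 1 Rlt_0_1)).
    - intros eps heps; destruct (hsmall eps heps) as [N hN].
      exists N; intros n y hn _.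
      eapply Rle_lt_trans; [apply hrate|].
      eapply Rle_lt_trans; [|exact hN].
      apply Rmult_le_compat_l; [lra|].
      rewrite !pow_inv; apply Rinv_le_contravar; [apply pow_lt; lra|].
      apply Rle_pow; [lra | exact hn].
    - intros n y _; apply continuity_pt_filterlim, hP.
    - unfold Boule; simpl; rewrite Rminus_diag, Rabs_R0; lra. }
  assert (hxd : forall t, dominated w (x t)).
  { intros t i.
    apply (is_lim_seq_le (fun m => Rabs (P m t i)) (fun _ => w i)
             (Rabs (x t i)) (w i)).
    - intros m; apply hP.
    - apply (is_lim_seq_abs _ (Finite (x t i))), hlim.
    - apply is_lim_seq_const. }
  (* Both [x] and its Picard image are within [W / 2^n] of [P (S n)]: the first by [hrate], the
     second because the step halves the distance from [x] to [P n]. *)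
  assert (hfix : forall t i, x t i = picard_step F T x0 x t i).
  { intros t i; apply Rminus_diag_uniq.
    assert (h : Rabs (x t i - picard_step F T x0 x t i) <= 0).
    { apply (le_0_of_le_vanishing _ (fun n => 2 * W * (/ 2) ^ n)); [apply hgeom|].
      intros n.
      assert (h1 := hrate (S n) t i).
      assert (h2 : Rabs (P (S n) t i - picard_step F T x0 x t i)
                   <= 2 * W * (/ 2) ^ n / 2).
      { apply hstep; try apply hP; auto.
        intros r j; rewrite Rabs_minus_sym; apply hrate. }
      replace (x t i - picard_step F T x0 x t i)
        with ((x t i - P (S n) t i) + (P (S n) t i - picard_step F T x0 x t i)) by ring.
      eapply Rle_trans; [apply Rabs_triang|]; simpl pow in h1; lra. }
    apply Rabs_le_between in h; lra. }
  exists x; repeat split; auto.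
  - intros i; rewrite hfix; unfold picard_step.
    rewrite clip_id by (unfold Icc; lra).
    rewrite RInt_point; unfold zero; simpl; ring.
  - intros t i ht.
    (* On [[0,T]] the clip is the identity, so [x] agrees there with an unclipped integral, which is
       differentiable on the whole line. *)
    apply (D_in_ext _ (fun r => x0 i + RInt (fun r => F (x r) i) 0 r) _
             (fun r => F (x r) i)); auto.
    + intros r hr; rewrite (hfix r i); unfold picard_step.
      rewrite clip_id by exact hr; reflexivity.
    + apply is_derive_D_in.
      replace (F (x t) i) with (0 + F (x t) i) by ring.
      apply (is_derive_plus (fun _ => x0 i)); [apply is_derive_Reals, derivable_pt_lim_const|].
      apply (is_derive_RInt_of_continuous (fun r => F (x r) i)).
      intros r; apply hcont, hxc.
Qed.

(** * Weighted estimates in [H^s] *)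

Lemma Rpower_shell_ge_1 (lambda p : R) (j : nat) :
  1 < lambda -> 0 <= p -> 1 <= Rpower (shell lambda j) p.
Proof.
  intros hl hp; rewrite <- (Rpower_O (shell lambda j)).
  - apply Rle_Rpower; [apply pow_R1_Rle; lra | exact hp].
  - apply pow_lt; lra.
Qed.

Lemma Rpower_shell_S (lambda p : R) (j : nat) :
  1 < lambda ->
  Rpower (shell lambda (S j)) p = Rpower lambda p * Rpower (shell lambda j) p.
Proof.
  intros hl; unfold shell; simpl pow.
  symmetry; apply Rpower_mult_distr; [lra | apply pow_lt; lra].
Qed.

Lemma Hs_term_ge_0 (lambda s : R) (u : nat -> R) (j : nat) :
  0 <= Hs_term lambda s u j.
Proof.
  apply Rmult_le_pos; [left; apply exp_pos | apply pow2_ge_0].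
Qed.

Lemma Hs_term_le_Series (lambda s : R) (u : nat -> R) (j : nat) :
  in_Hs lambda s u -> Hs_term lambda s u j <= Series (Hs_term lambda s u).
Proof.
  intros hu; eapply Rle_trans; [|apply (sum_incr (Hs_term lambda s u) j)].
  - destruct j; simpl; [lra|].
    assert (h := cond_pos_sum (Hs_term lambda s u) j (Hs_term_ge_0 lambda s u)); lra.
  - apply is_series_Reals, Series_correct, hu.
  - apply Hs_term_ge_0.
Qed.

(** One term of a nonnegative series is at most its sum, and [lambda_j >= 1] with [theta <= s] gives
    [lambda_j^(2 theta) <= lambda_j^(2 s)]. The regularity threshold enters here. *)
Lemma coupling_le_Hs_norm (lambda theta s : R) (u : nat -> R) (j : nat) :
  1 < lambda -> theta <= s -> in_Hs lambda s u ->
  Rpower (shell lambda j) theta * Rabs (u j) <= Hs_norm lambda s u.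
Proof.
  intros hl hs hu.
  assert (hk : 0 <= Rpower (shell lambda j) theta * Rabs (u j))
    by (apply Rmult_le_pos; [left; apply exp_pos | apply Rabs_pos]).
  rewrite <- (sqrt_pow2 _ hk); apply sqrt_le_1_alt.
  eapply Rle_trans; [|apply (Hs_term_le_Series _ _ _ j hu)].
  unfold Hs_term; rewrite Rpow_mult_distr, pow2_abs.
  apply Rmult_le_compat_r; [apply pow2_ge_0|].
  simpl pow; rewrite Rmult_1_r, <- Rpower_plus.
  apply Rle_Rpower; [apply pow_R1_Rle; lra | lra].
Qed.

Lemma Hs_term_le (lambda s : R) (u v : nat -> R) (j : nat) :
  Rabs (u j) <= Rabs (v j) -> Hs_term lambda s u j <= Hs_term lambda s v j.
Proof.
  intros h; unfold Hs_term; apply Rmult_le_compat_l; [left; apply exp_pos|].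
  rewrite <- (pow2_abs (u j)), <- (pow2_abs (v j)).
  apply pow_incr; split; [apply Rabs_pos | exact h].
Qed.

Lemma in_Hs_le (lambda s : R) (u v : nat -> R) :
  (forall j, Rabs (u j) <= Rabs (v j)) -> in_Hs lambda s v -> in_Hs lambda s u.
Proof.
  intros h; apply (ex_series_le (K := R_AbsRing) (V := R_CompleteNormedModule)).
  intros j; unfold norm; simpl; unfold abs; simpl.
  rewrite Rabs_pos_eq by apply Hs_term_ge_0; apply Hs_term_le, h.
Qed.

Lemma Hs_norm_le (lambda s : R) (u v : nat -> R) :
  (forall j, Rabs (u j) <= Rabs (v j)) -> in_Hs lambda s v ->
  Hs_norm lambda s u <= Hs_norm lambda s v.
Proof.
  intros h hv; apply sqrt_le_1_alt, Series_le; [|exact hv].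
  intros j; split; [apply Hs_term_ge_0 | apply Hs_term_le, h].
Qed.

(** Comparison through [(u + v)^2 <= 2 u^2 + 2 v^2], whose defect is [(u - v)^2]. *)
Lemma in_Hs_plus (lambda s : R) (u v : nat -> R) :
  in_Hs lambda s u -> in_Hs lambda s v -> in_Hs lambda s (fun j => u j + v j).
Proof.
  intros hu hv.
  apply (ex_series_le (K := R_AbsRing) (V := R_CompleteNormedModule) _
    (fun j => 2 * (Hs_term lambda s u j + Hs_term lambda s v j))).
  - intros j; unfold norm; simpl; unfold abs; simpl.
    rewrite Rabs_pos_eq by apply Hs_term_ge_0; unfold Hs_term.
    assert (h := exp_pos (2 * s * ln (shell lambda j))).
    fold (Rpower (shell lambda j) (2 * s)) in h.
    assert (h2 := Rmult_le_pos _ _ (Rlt_le _ _ h) (pow2_ge_0 (u j - v j))); nra.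
  - apply (ex_series_scal (K := R_AbsRing) (V := R_NormedModule) 2).
    apply (ex_series_plus (K := R_AbsRing) (V := R_NormedModule)); assumption.
Qed.

Lemma in_Hs_abs (lambda s : R) (u : nat -> R) :
  in_Hs lambda s u -> in_Hs lambda s (fun j => Rabs (u j)).
Proof.
  apply in_Hs_le; intros j; rewrite Rabs_Rabsolu; lra.
Qed.

(** * An [H^s] majorant compatible with the shift *)

(** Convolution of [2 g] with the geometric sequence [eps^k]. For nonnegative [g] and [eps] it
    dominates both [2 g_j] and [eps w_{j-1}], hence leaves room for the inflow from the preceding
    shell. *)
Fixpoint hs_majorant (eps : R) (g : nat -> R) (j : nat) : R :=
  match j with
  | O => 2 * g O
  | S i => 2 * g (S i) + eps * hs_majorant eps g i
  end.

Lemma hs_majorant_ge_0 (eps : R) (g : nat -> R) (j : nat) :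
  0 <= eps -> (forall i, 0 <= g i) -> 0 <= hs_majorant eps g j.
Proof.
  intros he hg; induction j as [|j IH]; simpl.
  - assert (h := hg O); lra.
  - assert (h := hg (S j)); nra.
Qed.

(** A shift multiplies the squared weight by [lambda^(2 s)]. The smallness of [eps] makes the
    shifted contribution at most half of the preceding term, so the series of [w] is controlled by
    that of [g]. *)
Lemma hs_majorant_in_Hs (lambda s eps : R) (g : nat -> R) :
  1 < lambda -> 4 * eps ^ 2 * Rpower lambda (2 * s) <= 1 ->
  in_Hs lambda s g -> in_Hs lambda s (hs_majorant eps g).
Proof.
  intros hl he hg.
  set (w := hs_majorant eps g); set (y := Hs_term lambda s w).
  assert (hstep : forall j, y (S j) <= 8 * Hs_term lambda s g (S j) + y j / 2).
  { intros j; unfold y, Hs_term; rewrite Rpower_shell_S by exact hl.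
    change (w (S j)) with (2 * g (S j) + eps * w j).
    assert (hL := exp_pos (2 * s * ln lambda)).
    fold (Rpower lambda (2 * s)) in hL.
    assert (hS := exp_pos (2 * s * ln (shell lambda j))).
    fold (Rpower (shell lambda j) (2 * s)) in hS.
    set (Lam := Rpower lambda (2 * s)) in *.
    set (sg := Rpower (shell lambda j) (2 * s)) in *.
    assert (h1 : (2 * g (S j) + eps * w j) ^ 2
                 <= 8 * g (S j) ^ 2 + 2 * eps ^ 2 * w j ^ 2)
      by (assert (h := pow2_ge_0 (2 * g (S j) - eps * w j)); nra).
    assert (h2 : 0 <= Lam * sg) by nra.
    assert (h3 := Rmult_le_compat_l _ _ _ h2 h1).
    assert (h4 : 0 <= sg * w j ^ 2) by (apply Rmult_le_pos; [lra | apply pow2_ge_0]).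
    nra. }
  (* Subtracting [y n] makes the induction close: doubling [hstep] gives
     [2 y_{n+1} <= 16 h_{n+1} + y_n], with [h] the terms of [g]. *)
  assert (hsum : forall n, sum_n y n <= 16 * sum_n (Hs_term lambda s g) n - y n).
  { induction n as [|n IH].
    - rewrite !sum_O; unfold y, Hs_term, w; simpl hs_majorant.
      assert (h := Hs_term_ge_0 lambda s g O); unfold Hs_term in h; lra.
    - rewrite !sum_Sn; unfold plus; simpl.
      assert (h := hstep n); assert (h' := Hs_term_ge_0 lambda s w n); fold y in h'; lra. }
  assert (hy : forall n, 0 <= y n) by (intros n; apply Hs_term_ge_0).
  destruct (ex_finite_lim_seq_incr (sum_n y) (16 * Series (Hs_term lambda s g)))
    as [l hl'].
  - intros n; rewrite sum_Sn; unfold plus; simpl; assert (h := hy (S n)); lra.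
  - intros n; assert (h := hsum n); assert (h' := hy n).
    assert (h2 : sum_n (Hs_term lambda s g) n <= Series (Hs_term lambda s g)).
    { rewrite sum_n_Reals; apply sum_incr; [|apply Hs_term_ge_0].
      apply is_series_Reals, Series_correct, hg. }
    lra.
  - exists l; exact hl'.
Qed.

(** * Size and Lipschitz constant of the dyadic field *)

(** A weighted sup bound: all that the quadratic terms require of the [H^s] norm. *)
Definition coupling_bounded (lambda theta M : R) (u : nat -> R) : Prop :=
  forall j, Rpower (shell lambda j) theta * Rabs (u j) <= M.

(** The weights increase with the shell, so the factor of index [j + 1] can absorb the weight of
    shell [j]. *)
Lemma coupling_bounded_S (lambda theta M : R) (u : nat -> R) (j : nat) :
  1 < lambda -> 0 < theta -> coupling_bounded lambda theta M u ->
  Rpower (shell lambda j) theta * Rabs (u (S j)) <= M.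
Proof.
  intros hl ht hu; eapply Rle_trans; [|apply (hu (S j))].
  apply Rmult_le_compat_r; [apply Rabs_pos|].
  apply Rle_Rpower_l; [lra|]; unfold shell; split; [apply pow_lt; lra|].
  apply Rle_pow; [lra | lia].
Qed.

Lemma coupling_bounded_abs (lambda theta M : R) (u : nat -> R) (j : nat) :
  1 < lambda -> 0 < theta -> coupling_bounded lambda theta M u -> Rabs (u j) <= M.
Proof.
  intros hl ht hu; eapply Rle_trans; [|apply (hu j)].
  assert (h := Rpower_shell_ge_1 lambda theta j hl (Rlt_le _ _ ht)).
  assert (h' := Rabs_pos (u j)); nra.
Qed.

Lemma Rabs_coupled_mult_le (k x y M Y : R) :
  0 <= k -> k * Rabs x <= M -> Rabs y <= Y -> Rabs (k * x * y) <= M * Y.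
Proof.
  intros hk hx hy; rewrite !Rabs_mult, (Rabs_pos_eq k) by exact hk.
  apply Rmult_le_compat; auto; try apply Rabs_pos.
  apply Rmult_le_pos; [exact hk | apply Rabs_pos].
Qed.

(** Leibniz splitting: each difference is paired with a factor that absorbs the weight [k], so only
    [y] and [x'] need weighted bounds. *)
Lemma coupled_product_lipschitz (k x y x' y' M d : R) :
  0 <= k -> k * Rabs y <= M -> k * Rabs x' <= M ->
  Rabs (x - x') <= d -> Rabs (y - y') <= d ->
  Rabs (k * x * y - k * x' * y') <= 2 * M * d.
Proof.
  intros hk hy hx' hx hyy.
  replace (k * x * y - k * x' * y')
    with (k * y * (x - x') + k * x' * (y - y')) by ring.
  eapply Rle_trans; [apply Rabs_triang|].
  assert (h1 := Rabs_coupled_mult_le k y (x - x') M d hk hy hx).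
  assert (h2 := Rabs_coupled_mult_le k x' (y - y') M d hk hx' hyy); lra.
Qed.

Lemma inflow_lipschitz (lambda theta M d : R) (u v : nat -> R) (j : nat) :
  0 <= M -> coupling_bounded lambda theta M u -> coupling_bounded lambda theta M v ->
  (forall i, Rabs (u i - v i) <= d) ->
  Rabs (inflow lambda theta u j - inflow lambda theta v j) <= 2 * M * d.
Proof.
  intros hM hu hv hd; destruct j as [|j]; cbn [inflow].
  - rewrite Rminus_diag, Rabs_R0.
    assert (0 <= d) by (eapply Rle_trans; [apply Rabs_pos | apply (hd O)]); nra.
  - simpl pow; rewrite !Rmult_1_r, <- !Rmult_assoc.
    apply coupled_product_lipschitz; auto; left; apply exp_pos.
Qed.

(** The two sequences are merged into one indexed by [nat + nat], so that the abstract results apply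
    to the coupled system. *)
Definition dyadic_field (lambda theta : R) (f : nat -> R) (x : nat + nat -> R)
    (i : nat + nat) : R :=
  let a j := x (inl j) in
  let b j := x (inr j) in
  match i with
  | inl j => rhs_a lambda theta f a b j
  | inr j => rhs_b lambda theta a b j
  end.

(** The forcing cancels; an [a] equation has four quadratic terms, each contributing [2 M d], and a
    [b] equation only two. *)
Lemma dyadic_field_lipschitz (lambda theta M : R) (f : nat -> R)
  (x y : nat + nat -> R) (d : R) (i : nat + nat) :
  1 < lambda -> 0 < theta ->
  coupling_bounded lambda theta M (fun j => x (inl j)) ->
  coupling_bounded lambda theta M (fun j => x (inr j)) ->
  coupling_bounded lambda theta M (fun j => y (inl j)) ->
  coupling_bounded lambda theta M (fun j => y (inr j)) ->
  (forall k, Rabs (x k - y k) <= d) ->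
  Rabs (dyadic_field lambda theta f x i - dyadic_field lambda theta f y i)
    <= 8 * M * d.
Proof.
  intros hl ht xa xb ya yb hd.
  assert (hk : forall j, 0 <= Rpower (shell lambda j) theta)
    by (intros j; left; apply exp_pos).
  assert (hM : 0 <= M).
  { eapply Rle_trans; [apply Rabs_pos|].
    apply (coupling_bounded_abs lambda theta M _ O hl ht xa). }
  assert (hd0 : 0 <= d) by (eapply Rle_trans; [apply Rabs_pos | apply (hd (inl O))]).
  destruct i as [j|j]; unfold dyadic_field, rhs_a, rhs_b.
  - assert (h1 := coupled_product_lipschitz (Rpower (shell lambda j) theta)
      (x (inl j)) (x (inl (S j))) (y (inl j)) (y (inl (S j))) M d (hk j)
      (coupling_bounded_S _ _ _ _ j hl ht xa) (ya j) (hd _) (hd _)).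
    assert (h2 := coupled_product_lipschitz (Rpower (shell lambda j) theta)
      (x (inr j)) (x (inr (S j))) (y (inr j)) (y (inr (S j))) M d (hk j)
      (coupling_bounded_S _ _ _ _ j hl ht xb) (yb j) (hd _) (hd _)).
    assert (h3 := inflow_lipschitz lambda theta M d _ _ j hM xa ya (fun i => hd (inl i))).
    assert (h4 := inflow_lipschitz lambda theta M d _ _ j hM xb yb (fun i => hd (inr i))).
    apply Rabs_le_between in h1, h2, h3, h4; apply Rabs_le; lra.
  - assert (h1 := coupled_product_lipschitz (Rpower (shell lambda j) theta)
      (x (inl j)) (x (inr (S j))) (y (inl j)) (y (inr (S j))) M d (hk j)
      (coupling_bounded_S _ _ _ _ j hl ht xb) (ya j) (hd _) (hd _)).
    assert (h2 := coupled_product_lipschitz (Rpower (shell lambda j) theta)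
      (x (inr j)) (x (inl (S j))) (y (inr j)) (y (inl (S j))) M d (hk j)
      (coupling_bounded_S _ _ _ _ j hl ht xa) (yb j) (hd _) (hd _)).
    assert (h0 := Rmult_le_pos _ _ hM hd0).
    apply Rabs_le_between in h1, h2; apply Rabs_le; lra.
Qed.

Definition delay (w : nat -> R) (j : nat) : R :=
  match j with O => 0 | S i => w i end.

Lemma Rabs_inflow_le (lambda theta M : R) (u w : nat -> R) (j : nat) :
  coupling_bounded lambda theta M u -> (forall i, Rabs (u i) <= w i) ->
  Rabs (inflow lambda theta u j) <= M * delay w j.
Proof.
  intros hu hw; destruct j as [|j]; cbn [inflow delay].
  - rewrite Rabs_R0; lra.
  - simpl pow; rewrite Rmult_1_r, <- Rmult_assoc.
    apply Rabs_coupled_mult_le; auto; left; apply exp_pos.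
Qed.

(** In each product over shells [j] and [j + 1] the latter factor takes the weight and the former is
    bounded by [w j]. Only [w] at [j] and [j - 1] remains, which the recursion of [hs_majorant] can
    absorb. *)
Lemma dyadic_field_bound (lambda theta M : R) (f w : nat -> R)
  (x : nat + nat -> R) (j : nat) :
  1 < lambda -> 0 < theta ->
  coupling_bounded lambda theta M (fun j => x (inl j)) ->
  coupling_bounded lambda theta M (fun j => x (inr j)) ->
  (forall i, Rabs (x (inl i)) <= w i) -> (forall i, Rabs (x (inr i)) <= w i) ->
  Rabs (dyadic_field lambda theta f x (inl j))
    <= 2 * M * (w j + delay w j) + Rabs (f j) /\
  Rabs (dyadic_field lambda theta f x (inr j)) <= 2 * M * w j.
Proof.
  intros hl ht xa xb wa wb.
  assert (hk : 0 <= Rpower (shell lambda j) theta) by (left; apply exp_pos).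
  assert (hmul : forall u v : nat -> R,
    coupling_bounded lambda theta M v -> (forall i, Rabs (u i) <= w i) ->
    Rabs (Rpower (shell lambda j) theta * u j * v (S j)) <= M * w j).
  { intros u v hv hu.
    replace (Rpower (shell lambda j) theta * u j * v (S j))
      with (Rpower (shell lambda j) theta * v (S j) * u j) by ring.
    apply Rabs_coupled_mult_le; auto; apply coupling_bounded_S; assumption. }
  assert (haa := hmul _ _ xa wa); assert (hbb := hmul _ _ xb wb).
  assert (hab := hmul _ _ xb wa); assert (hba := hmul _ _ xa wb).
  assert (hia := Rabs_inflow_le _ _ _ _ _ j xa wa).
  assert (hib := Rabs_inflow_le _ _ _ _ _ j xb wb).
  assert (hf := Rle_refl (Rabs (f j))).
  unfold dyadic_field, rhs_a, rhs_b; cbv beta in *.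
  apply Rabs_le_between in haa, hbb, hab, hba, hia, hib, hf.
  split; apply Rabs_le; lra.
Qed.

Lemma continuous_dyadic_field (lambda theta : R) (f : nat -> R)
  (x : R -> nat + nat -> R) :
  continuous_paths x -> continuous_paths (fun r => dyadic_field lambda theta f (x r)).
Proof.
  intros hx i t; apply continuity_pt_filterlim.
  assert (h : forall k, continuity_pt (fun r => x r k) t)
    by (intros k; apply continuity_pt_filterlim, hx).
  assert (hc : forall c, continuity_pt (fun _ => c) t)
    by (intros c; apply continuity_pt_const; intros ? ?; reflexivity).
  assert (hsum : forall g k, continuity_pt g t -> continuity_pt k t ->
    continuity_pt (fun r => g r + k r) t) by (intros; apply continuity_pt_plus; auto).
  assert (hopp : forall g, continuity_pt g t -> continuity_pt (fun r => - g r) t)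
    by (intros; apply continuity_pt_opp; auto).
  assert (hmul : forall g k, continuity_pt g t -> continuity_pt k t ->
    continuity_pt (fun r => g r * k r) t) by (intros; apply continuity_pt_mult; auto).
  assert (hin : forall (inj : nat -> nat + nat) j, continuity_pt
    (fun r => inflow lambda theta (fun k => x r (inj k)) j) t).
  { intros inj [|j]; cbn [inflow]; simpl pow; auto 8. }
  destruct i as [j|j]; unfold dyadic_field, rhs_a, rhs_b, Rminus;
    repeat first [apply hsum | apply hopp | apply hmul | apply h | apply hc | apply hin].
Qed.

(** * Uniqueness for the dyadic system *)

Lemma bounded_in_Hs_coupling (lambda theta s T : R) (u : R -> nat -> R) :
  1 < lambda -> theta <= s -> bounded_in_Hs lambda s T u ->
  exists M, forall t, Icc 0 T t -> coupling_bounded lambda theta M (u t).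
Proof.
  intros hl hs [hin [M hM]]; exists M; intros t ht j.
  eapply Rle_trans; [apply (coupling_le_Hs_norm _ _ s) | apply hM]; auto.
Qed.

Lemma coupling_bounded_weaken (lambda theta M N : R) (u : nat -> R) :
  M <= N -> coupling_bounded lambda theta M u -> coupling_bounded lambda theta N u.
Proof. intros h hu j; eapply Rle_trans; [apply hu | exact h]. Qed.

Lemma dyadic_solution_unique (lambda theta s T : R) (f a0 b0 : nat -> R)
  (a b a' b' : R -> nat -> R) :
  1 < lambda -> 0 < theta -> theta <= s ->
  is_solution lambda theta s T f a0 b0 a b ->
  is_solution lambda theta s T f a0 b0 a' b' ->
  forall t, Icc 0 T t -> forall j, a' t j = a t j /\ b' t j = b t j.
Proof.
  intros hl ht hs [_ _ ea eb ia ib ba bb] [_ _ ea' eb' ia' ib' ba' bb'].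
  destruct (bounded_in_Hs_coupling _ theta _ _ _ hl hs ba) as [M1 h1].
  destruct (bounded_in_Hs_coupling _ theta _ _ _ hl hs bb) as [M2 h2].
  destruct (bounded_in_Hs_coupling _ theta _ _ _ hl hs ba') as [M3 h3].
  destruct (bounded_in_Hs_coupling _ theta _ _ _ hl hs bb') as [M4 h4].
  set (M := Rmax (Rmax M1 M2) (Rmax M3 M4)).
  assert (l12 := Rmax_l (Rmax M1 M2) (Rmax M3 M4)).
  assert (l34 := Rmax_r (Rmax M1 M2) (Rmax M3 M4)).
  assert (l1 := Rmax_l M1 M2); assert (l2 := Rmax_r M1 M2).
  assert (l3 := Rmax_l M3 M4); assert (l4 := Rmax_r M3 M4).
  fold M in l12, l34.
  set (x := fun r (i : nat + nat) => match i with inl j => a r j | inr j => b r j end).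
  set (y := fun r (i : nat + nat) => match i with inl j => a' r j | inr j => b' r j end).
  assert (k1 : forall t, Icc 0 T t -> coupling_bounded lambda theta M (a t))
    by (intros t htt; apply (coupling_bounded_weaken _ _ M1); [lra | auto]).
  assert (k2 : forall t, Icc 0 T t -> coupling_bounded lambda theta M (b t))
    by (intros t htt; apply (coupling_bounded_weaken _ _ M2); [lra | auto]).
  assert (k3 : forall t, Icc 0 T t -> coupling_bounded lambda theta M (a' t))
    by (intros t htt; apply (coupling_bounded_weaken _ _ M3); [lra | auto]).
  assert (k4 : forall t, Icc 0 T t -> coupling_bounded lambda theta M (b' t))
    by (intros t htt; apply (coupling_bounded_weaken _ _ M4); [lra | auto]).
  assert (hxy : forall t i, Icc 0 T t -> y t i = x t i).
  { intros t0 i0 ht0.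
    (* All four sequences satisfy the coupling bound [M], whence the Lipschitz constant [8 M] and
       the crude initial distance [2 M]. No smallness of [T] is needed. *)
    apply (sup_lipschitz_ode_unique _ (dyadic_field lambda theta f) T (8 * M) (2 * M));
      try assumption.
    - assert (h := coupling_bounded_abs _ _ _ _ O hl ht (k1 t0 ht0)).
      assert (h' := Rabs_pos (a t0 O)); lra.
    - intros t [j|j] htt; [apply ea' | apply eb']; exact htt.
    - intros t [j|j] htt; [apply ea | apply eb]; exact htt.
    - intros [j|j]; simpl; congruence.
    - assert (hdiff : forall p q, Rabs p <= M -> Rabs q <= M -> Rabs (p - q) <= 2 * M).
      { intros p q hp hq; apply Rabs_le_between in hp, hq; apply Rabs_le; lra. }
      intros t [j|j] htt; apply hdiff;
        apply (coupling_bounded_abs lambda theta M _ j); cbn; auto.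
    - intros t d htt hd i; apply dyadic_field_lipschitz; cbn; auto. }
  intros t htt j; split; [apply (hxy t (inl j) htt) | apply (hxy t (inr j) htt)].
Qed.

(** * Choice of constants and local existence *)

Lemma hs_majorant_split (eps : R) (g : nat -> R) (j : nat) :
  hs_majorant eps g j = 2 * g j + eps * delay (hs_majorant eps g) j.
Proof. destruct j; simpl; lra. Qed.

Theorem theorem4p2 (lambda theta s : R) (f a0 b0 : nat -> R)
  (hlambda : 1 < lambda) (htheta : 0 < theta) (hs : theta <= s)
  (ha0 : in_Hs lambda s a0) (hb0 : in_Hs lambda s b0) (hf : in_Hs lambda s f) :
  exists T : R, 0 < T /\
    exists a b : R -> nat -> R,
      is_solution lambda theta s T f a0 b0 a b /\
      forall a' b' : R -> nat -> R,
        is_solution lambda theta s T f a0 b0 a' b' ->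
        forall t, Icc 0 T t -> forall j, a' t j = a t j /\ b' t j = b t j.
Proof.
  set (g := fun j => Rabs (a0 j) + Rabs (b0 j) + Rabs (f j)).
  assert (hg : in_Hs lambda s g)
    by (apply (in_Hs_plus _ _ (fun j => Rabs (a0 j) + Rabs (b0 j)));
        [apply in_Hs_plus|]; apply in_Hs_abs; assumption).
  set (Lam := Rpower lambda (2 * s)).
  assert (hLam : 1 <= Lam).
  { rewrite <- (Rpower_O lambda) by lra; apply Rle_Rpower; lra. }
  (* With this choice [4 eps^2 Lam = 2 eps <= 1], the smallness needed for [w] to lie in [H^s]. *)
  set (eps := / (2 * Lam)).
  assert (heL : eps * Lam = / 2) by (unfold eps; field; lra).
  assert (he0 : 0 < eps) by (apply Rinv_0_lt_compat; lra).
  assert (he1 : eps <= / 2) by nra.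
  set (w := hs_majorant eps g).
  assert (hw : in_Hs lambda s w).
  { apply hs_majorant_in_Hs; auto; fold Lam.
    replace (4 * eps ^ 2 * Lam) with (4 * eps * (eps * Lam)) by ring.
    rewrite heL; lra. }
  assert (hw0 : forall j, 0 <= w j).
  { intros j; apply hs_majorant_ge_0; [lra|]; intros i; unfold g.
    assert (h1 := Rabs_pos (a0 i)); assert (h2 := Rabs_pos (b0 i)).
    assert (h3 := Rabs_pos (f i)); lra. }
  (* The added 1 keeps [M] away from 0 even for zero data, and later gives [T <= 1]. *)
  set (M := Hs_norm lambda s w + 1).
  assert (hM : 1 <= M) by (assert (h := sqrt_pos (Series (Hs_term lambda s w)));
                           unfold M, Hs_norm; lra).
  assert (hdom : forall u, (forall j, Rabs (u j) <= w j) ->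
            coupling_bounded lambda theta M u).
  { intros u hu j.
    apply Rle_trans with (Rpower (shell lambda j) theta * Rabs (w j)).
    - apply Rmult_le_compat_l; [left; apply exp_pos|].
      rewrite (Rabs_pos_eq (w j)); auto.
    - assert (h := coupling_le_Hs_norm lambda theta s w j hlambda hs hw).
      unfold M; lra. }
  (* Then [T * 8 M = eps / 2 <= 1/2], the contraction condition, and [2 T M = eps / 8], used for the
     self-map condition. *)
  set (T := eps / (16 * M)).
  assert (hTM : T * M = eps / 16) by (unfold T; field; lra).
  assert (hT : 0 < T) by (apply Rdiv_lt_0_compat; lra).
  assert (hT1 : T <= 1) by nra.
  assert (hsh : forall j, 0 <= delay w j) by (intros [|j]; simpl; [lra | auto]).
  set (x0 := fun i : nat + nat => match i with inl j => a0 j | inr j => b0 j end).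
  set (B := fun i : nat + nat => match i with
              | inl j => 2 * M * (w j + delay w j) + Rabs (f j)
              | inr j => 2 * M * w j end).
  set (w2 := fun i : nat + nat => match i with inl j => w j | inr j => w j end).
  (* One copy of [g_j] in [w_j = 2 g_j + eps w_{j-1}] pays for the data and, as [T <= 1], the
     forcing. The rest covers the quadratic part, at most [eps / 8 * (w_j + w_{j-1})]. *)
  assert (hx0 : forall i, Rabs (x0 i) + T * B i <= w2 i).
  { assert (hwj : forall j, w j = 2 * g j + eps * delay w j)
      by (intros j; apply hs_majorant_split).
    assert (hgj : forall j, 0 <= Rabs (a0 j) /\ 0 <= Rabs (b0 j) /\ 0 <= Rabs (f j))
      by (intros j; repeat split; apply Rabs_pos).
    intros [j|j]; unfold x0, B, w2; destruct (hgj j) as [p1 [p2 p3]];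
      specialize (hwj j); unfold g in hwj; assert (q1 := hw0 j); assert (q2 := hsh j).
    - replace (T * (2 * M * (w j + delay w j) + Rabs (f j)))
        with (2 * (T * M) * (w j + delay w j) + T * Rabs (f j)) by ring.
      rewrite hTM; nra.
    - replace (T * (2 * M * w j)) with (2 * (T * M) * w j) by ring.
      rewrite hTM; nra. }
  assert (hB0 : forall i, 0 <= B i).
  { intros [j|j]; unfold B; assert (q1 := hw0 j); assert (q2 := hsh j);
      assert (q3 := Rabs_pos (f j)); nra. }
  assert (hxd : forall x, dominated w2 x ->
    coupling_bounded lambda theta M (fun j => x (inl j)) /\
    coupling_bounded lambda theta M (fun j => x (inr j))).
  { intros x hx; split; apply hdom; intros j; [apply (hx (inl j)) | apply (hx (inr j))]. }
  destruct (picard_lindelof_sup _ (dyadic_field lambda theta f) T (8 * M) M x0 B w2)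
    as [x [hxc [hxw [hxi hxD]]]]; auto; try lra.
  - intros x hx; apply continuous_dyadic_field, hx.
  - intros x i hx; destruct (hxd x hx) as [xa xb].
    assert (h := fun j => dyadic_field_bound lambda theta M f w x j hlambda htheta
                   xa xb (fun i => hx (inl i)) (fun i => hx (inr i))).
    destruct i as [j|j]; apply h.
  - assert (h := fun j => Rle_trans _ _ _ (Rle_abs (w j))
      (coupling_bounded_abs lambda theta M w j hlambda htheta
        (hdom w (fun j => Req_le _ _ (Rabs_pos_eq _ (hw0 j)))))).
    intros [j|j]; apply h.
  - intros x y d hx hy hd i.
    apply dyadic_field_lipschitz; auto; apply hxd; assumption.
  - set (a := fun t j => x t (inl j)); set (b := fun t j => x t (inr j)).
    assert (hsol : is_solution lambda theta s T f a0 b0 a b).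
    { assert (hC1 : forall i, C1_on T (fun t => x t i)).
      { intros i; exists (fun r => dyadic_field lambda theta f (x r) i).
        intros t ht; split; [apply hxD, ht|].
        intros e he.
        destruct (proj2 (continuity_pt_filterlim _ t)
          (continuous_dyadic_field lambda theta f x hxc i t) e he) as [alp [halp h]].
        exists alp; split; [exact halp|].
        intros r [[_ hr1] hr2]; apply h; repeat split; assumption. }
      (* Domination by one fixed [w] at all times bounds the norms uniformly by that of [w]. *)
      assert (hbd : forall u : R -> nat -> R, (forall t j, Rabs (u t j) <= w j) ->
                bounded_in_Hs lambda s T u).
      { intros u hu.
        assert (hu' : forall t j, Rabs (u t j) <= Rabs (w j))
          by (intros t j; rewrite (Rabs_pos_eq (w j)); auto).
        split; [intros t _; apply (in_Hs_le _ _ _ w); auto|].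
        exists (Hs_norm lambda s w); intros t _; apply Hs_norm_le; auto. }
      split.
      - intros j; apply hC1.
      - intros j; apply hC1.
      - intros j t ht; apply (hxD t (inl j) ht).
      - intros j t ht; apply (hxD t (inr j) ht).
      - intros j; apply (hxi (inl j)).
      - intros j; apply (hxi (inr j)).
      - apply hbd; intros t j; apply (hxw t (inl j)).
      - apply hbd; intros t j; apply (hxw t (inr j)). }
    exists T; split; [exact hT|]; exists a, b; split; [exact hsol|].
    (* A competing solution need not be dominated by [w]; its own [H^s] bounds suffice for
       uniqueness. *)
    intros a' b' hsol'.
    apply (dyadic_solution_unique lambda theta s T f a0 b0); assumption.
Qed.
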